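(* Let $n\ge 2$ and $g\ge 3$, and let $\mathcal M^{\mathrm o}_g(n)$ be the number of MAB pairs $(u,v)$ of binary words with $|u|=|v|=n$ and $\mathrm{lsb}(u,v)+\mathrm{lsb}(v,u)-n=g$. Then $$\mathcal M^{\mathrm o}_g(n)=2\sum_{i=g+1}^{n-1}\ \sum_{l_2=0}^{n-i-2}\ \sum_{l_1=l_2+2}^{n-i}\ \sum_{k=l_1}^{g+l_2}\ \sum_{m=k'}^{n-j+k}\frac{l_1-l_2}{n-i}\binom{n-i}{l_1}\binom{n-i}{l_2}\cdot{}_{A_{l_2}}N_{A_{l_1}}^{A_k}\cdot\frac{l_1-l_2}{n-j}\binom{n-j}{m-k}\binom{n-j}{m-k'},$$ where in each term $j=n+g-i$, $k'=k+l_1-l_2$, $A_{l_1}=(l_1,n-i-l_1)$, $A_{l_2}=(l_2,n-i-l_2)$ and $A_k=(k,j-k)$ (empty sums are $0$).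
   Context: Let $\Sigma=\{a,b\}$. For a word $w$ and a letter $c$, $|w|_c$ denotes the number of occurrences of $c$ in $w$. Two words $x,y$ are abelian equivalent, written $x\sim_{\mathrm{abl}}y$, if $|x|_c=|y|_c$ for all $c\in\Sigma$. For words $u,v$: a pair $(x,y)$ is an internal abelian-border of $(u,v)$ if $x$ is a nonempty proper suffix of $u$, $y$ is a proper prefix of $v$, and $x\sim_{\mathrm{abl}}y$; it is an external abelian-border of $(u,v)$ if $x$ is a nonempty proper prefix of $u$, $y$ is a proper suffix of $v$, and $x\sim_{\mathrm{abl}}y$. The pair $(u,v)$ is mutually abelian-bordered (MAB) if it has both an internal and an external abelian-border, and mutually abelian-unbordered (MAU) if it has neither. If $(u,v)$ has an internal abelian-border, $\mathrm{sb}(u,v)$ denotes its internal abelian-border $(x,y)$ of minimal length and $\mathrm{lsb}(u,v)=|x|$ is that minimal length. A lattice path is a finite sequence of points of $\mathbb Z^2$ in which each consecutive difference is $(1,0)$ (an east step) or $(0,1)$ (a north step). The word $w(p)\in\Sigma^*$ of a lattice path $p$ records its steps in order, writing $a$ for an east step and $b$ for a north step; conversely, for a point $A\in\mathbb Z^2$ and a word $w$, $p_A(w)$ is the lattice path starting at $A$ whose word is $w$. For lattice paths $p,q$, $p\cap q$ denotes the set of lattice points lying on both. For distinct lattice points $A,B,C$, ${}_{A}\mathcal N_{B}^{C}$ is the set of triples $(p,q,p')$ where $p$ is a lattice path from $A$ to $C$, $q$ is a lattice path from $B$ to $C$, $p'=p_B(w(p))$, $p\cap q=\{C\}$ and $q\cap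 p'=\{B\}$; and ${}_{A}N_{B}^{C}=|{}_{A}\mathcal N_{B}^{C}|$. Binomial coefficients $\binom{N}{r}$ are $0$ when $r<0$ or $r>N$. *)

(* Defs.v *)
From HB Require Import structures.
From mathcomp Require Import all_boot all_order all_algebra.
Set Implicit Arguments. Unset Strict Implicit. Unset Printing Implicit Defensive.
Import Order.TTheory GRing.Theory Num.Theory.

Definition word := seq bool.
Definition la : bool := true.
Definition lb : bool := false.

Definition abl (x y : word) : bool := [forall c : bool, count_mem c x == count_mem c y].

Definition is_int_border (u v x y : word) : bool :=
  [&& x != [::], suffix x u, x != u, prefix y v, y != v & abl x y].

Definition is_ext_border (u v x y : word) : bool :=
  [&& x != [::], prefix x u, x != u, suffix y v, y != v & abl x y].

(* every suffix of u is [drop i u] with i <= size u; every prefix of v is [take j v] *)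
Definition has_int_border (u v : word) : bool :=
  [exists i : 'I_(size u).+1, exists j : 'I_(size v).+1,
     is_int_border u v (drop i u) (take j v)].

Definition has_ext_border (u v : word) : bool :=
  [exists i : 'I_(size u).+1, exists j : 'I_(size v).+1,
     is_ext_border u v (take i u) (drop j v)].

Definition MAB (u v : word) : bool := has_int_border u v && has_ext_border u v.
Definition MAU (u v : word) : bool := ~~ has_int_border u v && ~~ has_ext_border u v.

(* lsb(u,v): the minimal length |x| of an internal abelian-border (x,y) of (u,v)
   (meaningful when (u,v) has an internal abelian-border). *)
Definition lsb (u v : word) : nat :=
  find (fun l => [exists i : 'I_(size u).+1, exists j : 'I_(size v).+1,
                   (size (drop i u) == l) && is_int_border u v (drop i u) (take j v)])
       (iota 0 (size u).+1).

(* Lattice points and lattice paths.  A lattice path is represented by its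
   starting point and its word: p_A(w) is the sequence of points visited. *)
Definition point := (int * int)%type.

Definition step (P : point) (c : bool) : point :=
  if c then (P.1 + 1, P.2)%R else (P.1, P.2 + 1)%R.

Definition pts (A : point) (w : word) : seq point := A :: scanl step A w.

Definition endpt (A : point) (w : word) : point := last A (pts A w).

Definition meet_exactly (p q : seq point) (C : point) : bool :=
  [&& C \in p, C \in q & all (fun P => (P \in q) ==> (P == C)) p].

(* Any lattice path from A to C has exactly (C.1-A.1)+(C.2-A.2) steps. *)
Definition path_len (A C : point) : nat := absz ((C.1 - A.1) + (C.2 - A.2))%R.

(* _A N_B^C : the number of triples (p,q,p') with p : A -> C, q : B -> C,
   p' = p_B(w(p)), p \cap q = {C}, q \cap p' = {B}.  Since p' is determined
   by p, we count pairs of words (w(p), w(q)). *)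
Definition Ncount (A B C : point) : nat :=
  #|[set w : (path_len A C).-tuple bool * (path_len B C).-tuple bool |
      [&& endpt A w.1 == C, endpt B w.2 == C,
          meet_exactly (pts A w.1) (pts B w.2) C &
          meet_exactly (pts B w.2) (pts B w.1) B]]|.

Definition Mo (g n : nat) : nat :=
  #|[set p : n.-tuple bool * n.-tuple bool |
      MAB p.1 p.2 &&
      ((lsb p.1 p.2)%:Z + (lsb p.2 p.1)%:Z - n%:Z == g%:Z)%R]|.

Definition Apt (l s : nat) : point := (l%:Z, s%:Z - l%:Z)%R.

(* Main.v *)
Require Import Defs.
From HB Require Import structures.
From mathcomp Require Import all_boot all_order all_algebra.
From mathcomp Require Import zify ring.
Import Order.TTheory GRing.Theory Num.Theory.
Set Implicit Arguments. Unset Strict Implicit. Unset Printing Implicit Defensive.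

(* If lsb(u,v) = i and lsb(v,u) = j = n + g - i, put N = n - i and K = n - j = i - g
   and cut u = x1 x2 rev(x3) and v = y3 rev(y2) rev(y1) into blocks of sizes
   N, g, K and K, g, N.  The lattice paths of x1 and y1 from the origin do not
   meet again; continued by x2 and y2 they first meet at the end, which is
   minimality of j.  Likewise x3 and y3 do not meet, and minimality of i for
   their continuations by rev(x2) and rev(y2) says, read backwards from the
   common endpoint, that x2 and y2 issued from one point never meet again.
   Hence the triples (x1,y1), (x2,y2), (x3,y3) are linked only through the
   abscissae l2, l1, k, m, and the first and third factors are ballot-type
   numbers of nonintersecting pairs.  Exchanging the two letters swaps the cases
   l2 < l1 and l1 < l2, whence the factor 2. *)

(** * Sums over the words of a given length *)

Local Notation ht := (count_mem true).

(** A list of plain sequences instead of a tuple type: cutting a word into blocks then needs no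
    casts between lengths. *)
Fixpoint words (n : nat) : seq word :=
  if n is m.+1 then [seq true :: w | w <- words m] ++ [seq false :: w | w <- words m]
  else [:: [::]].

Lemma mem_words n w : (w \in words n) = (size w == n).
Proof.
elim: n w => [|n IH] [|c w] //=; rewrite mem_cat.
  by apply/negbTE; rewrite negb_or; apply/andP; split; apply/mapP => -[].
have inj b : injective (cons b : word -> word) by move=> ? ? [].
have other b : (b :: w \in [seq ~~ b :: w' | w' <- words n]) = false.
  by apply/negP => /mapP [w' _ []]; case: b.
case: c; first by rewrite (mem_map (inj true)) IH (other true) orbF eqSS.
by rewrite (mem_map (inj false)) IH (other false) eqSS.
Qed.

Lemma uniq_words n : uniq (words n).
Proof.
have inj b : injective (cons b : word -> word) by move=> ? ? [].
elim: n => [|n IH] //=; rewrite cat_uniq !map_inj_uniq ?IH //= andbT.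
by apply/hasPn => _ /mapP [w _ ->]; apply/mapP => -[].
Qed.

Lemma sum_tuple n (F : word -> nat) :
  \sum_(x : n.-tuple bool) F x = \sum_(w <- words n) F w.
Proof.
rewrite -(big_map (val : n.-tuple bool -> word) xpredT F); apply: perm_big.
apply: uniq_perm; last move=> w.
- by rewrite map_inj_uniq ?index_enum_uniq //; apply: val_inj.
- exact: uniq_words.
rewrite mem_words; apply/mapP/idP => [[x _ ->]|wn]; first by rewrite size_tuple.
by exists (Tuple wn); rewrite ?mem_index_enum.
Qed.

Lemma eq_sum_words n (F G : word -> nat) :
  (forall w, size w = n -> F w = G w) ->
  \sum_(w <- words n) F w = \sum_(w <- words n) G w.
Proof.
by move=> FG; apply: eq_big_seq => w; rewrite mem_words => /eqP; apply: FG.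
Qed.

Lemma sum_words0 (F : word -> nat) : \sum_(w <- words 0) F w = F [::].
Proof. by rewrite big_seq1. Qed.

Lemma sum_wordsS n (F : word -> nat) :
  \sum_(w <- words n.+1) F w =
  \sum_(w <- words n) F (true :: w) + \sum_(w <- words n) F (false :: w).
Proof. by rewrite /= big_cat !big_map. Qed.

Lemma sum_words_cat a b (F : word -> nat) :
  \sum_(w <- words (a + b)) F w =
  \sum_(x <- words a) \sum_(y <- words b) F (x ++ y).
Proof.
elim: a F => [|a IH] F; first by rewrite sum_words0.
by rewrite addSn !sum_wordsS !IH.
Qed.

Lemma sum_words_rcons n (F : word -> nat) :
  \sum_(w <- words n.+1) F w =
  \sum_(w <- words n) (F (rcons w true) + F (rcons w false)).
Proof.
rewrite -addn1 sum_words_cat; apply: eq_bigr => w _.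
by rewrite sum_wordsS !sum_words0 !cats1.
Qed.

Lemma sum_words_rev n (F : word -> nat) :
  \sum_(w <- words n) F (rev w) = \sum_(w <- words n) F w.
Proof.
elim: n F => [|n IH] F; first by rewrite !sum_words0.
rewrite sum_wordsS [RHS]sum_words_rcons big_split /=.
by rewrite -[X in _ = X + _]IH -[X in _ = _ + X]IH; congr (_ + _);
  apply: eq_bigr => w _; rewrite rev_cons.
Qed.

Lemma sum_words_negb n (F : word -> nat) :
  \sum_(w <- words n) F (map negb w) = \sum_(w <- words n) F w.
Proof.
elim: n F => [|n IH] F; first by rewrite !sum_words0.
by rewrite !sum_wordsS addnC -[X in _ = X + _]IH -[X in _ = _ + X]IH.
Qed.

Lemma sum_nat_delta a b c (F : nat -> nat) :
  \sum_(a <= l < b) (l == c) * F l = (a <= c < b) * F c.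
Proof.
case: (boolP (a <= c < b)) => [cab|ncab].
  rewrite (bigD1_seq c) ?iota_uniq ?mem_index_iota //= eqxx big1 ?addn0 // => l.
  by move=> /negbTE ->.
rewrite big_nat big1 // => l lab; case: eqP => // lc.
by rewrite lc (negbTE ncab) in lab.
Qed.

(** * Abelian borders as meetings of two paths *)

Definition meets (x y : word) (l : nat) : bool := ht (take l x) == ht (take l y).

(** The offsets [c] and [d] are the starting abscissae of two paths on a common antidiagonal. The
    shift [l.+1] leaves the starting time out, so the tested times are 1 to [i]. *)
Definition separated (c d : nat) (x y : word) (i : nat) : bool :=
  [forall l : 'I_i, c + ht (take l.+1 x) != d + ht (take l.+1 y)].

Lemma separatedP c d x y i :
  reflect (forall l, 0 < l <= i -> c + ht (take l x) <> d + ht (take l y))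
          (separated c d x y i).
Proof.
apply: (iffP forallP) => [H [|l] // /andP[_ li]|H l].
  by apply/eqP; exact: (H (Ordinal li)).
by apply/eqP; apply: H; have := ltn_ord l.
Qed.

Definition avoid (x y : word) (i : nat) : bool := separated 0 0 x y i.

Lemma avoidP x y i :
  reflect (forall l, 0 < l <= i -> ~~ meets x y l) (avoid x y i).
Proof. by apply: (iffP (separatedP _ _ _ _ _)) => H l /H /eqP. Qed.

Definition first_meet (x y : word) (i : nat) : bool :=
  meets x y i && avoid x y i.-1.

Lemma count_drop_rev (x : word) l :
  ht (drop (size x - l) x) = ht (take l (rev x)).
Proof. by rewrite -count_rev -take_rev. Qed.

Lemma size_ht (x : word) : size x = ht x + count_mem false x.
Proof. by rewrite -(count_predC (pred1 true)); congr addn; apply: eq_count => -[]. Qed.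

Lemma ablP x y : abl x y = (size x == size y) && (ht x == ht y).
Proof.
rewrite !size_ht; apply/forallP/idP => [H|/andP[/eqP H1 /eqP H2] [|]].
- by have := H true; have := H false; lia.
- by rewrite H2.
- by apply/eqP; lia.
Qed.

(** Abelian equivalent words have equal length, so nonemptiness passes from [x] to [y]; this is the
    only condition that is not already symmetric. *)
Lemma ext_int_border u v x y : is_ext_border u v x y = is_int_border v u y x.
Proof.
rewrite /is_ext_border /is_int_border !ablP (eq_sym (size x)) (eq_sym (ht x)).
case: (eqVneq (size y) (size x)) => [syx|]; last by rewrite !andbF.
have -> : (x != [::]) = (y != [::]) by rewrite -!size_eq0 syx.
by case: (y != [::]); case: (prefix x u); case: (x != u); case: (suffix y v); case: (y != v).
Qed.

Lemma has_ext_int u v : has_ext_border u v = has_int_border v u.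
Proof.
apply/existsP/existsP => -[i /existsP[j H]]; exists j; apply/existsP; exists i;
  by rewrite ?ext_int_border // -ext_int_border.
Qed.

(** A suffix of [u] is a reversed prefix of [rev u], and reversal keeps letter counts; so a border
    of length [l] is a meeting of the paths of [rev u] and [v] after [l] steps. *)
Definition border_len (u v : word) (l : nat) : bool :=
  (0 < l < size u) && meets (rev u) v l.

Lemma border_lenE u v (l : nat) : size u = size v ->
  [exists i : 'I_(size u).+1, exists j : 'I_(size v).+1,
     (size (drop i u) == l) && is_int_border u v (drop i u) (take j v)]
  = border_len u v l.
Proof.
move=> suv; apply/existsP/idP.
  move=> [i /existsP[j /andP[/eqP sl]]]; rewrite /is_int_border ablP /border_len /meets.
  have ilt := ltn_ord i; have jlt := ltn_ord j.
  move=> /and5P[d0 _ du _ /andP[_ /andP[/eqP]]].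
  rewrite size_takel; last by lia.
  move: sl d0 du; rewrite -size_eq0 size_drop => sl d0 du lj /eqP hh.
  have i0 : i != 0 :> nat by apply: contra du => /eqP ->; rewrite drop0.
  rewrite -count_drop_rev.
  have -> : size u - l = i by lia.
  have <- : j = l :> nat by lia.
  by rewrite hh eqxx andbT; lia.
move=> /andP[/andP[l0 lu]]; rewrite /meets -count_drop_rev => mt.
have iP : size u - l < (size u).+1 by lia.
have jP : l < (size v).+1 by lia.
exists (Ordinal iP); apply/existsP; exists (Ordinal jP) => /=.
have sd : size (drop (size u - l) u) = l by rewrite size_drop; lia.
have st : size (take l v) = l by rewrite size_takel; lia.
rewrite sd eqxx /is_int_border ablP sd st eqxx mt -size_eq0 sd.
rewrite prefix_take suffix_drop !andbT -lt0n l0 /=.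
have lv : l < size v by rewrite -suv.
by apply/andP; split; apply/eqP => /(congr1 size); rewrite ?sd ?st => E;
  [move: lu | move: lv]; rewrite [l in l < _]E ltnn.
Qed.

Lemma has_intE u v : size u = size v ->
  has_int_border u v = has (border_len u v) (iota 0 (size u).+1).
Proof.
move=> suv; apply/existsP/hasP => [[i /existsP[j H]]|[l _]].
  exists (size (drop i u)); first by rewrite mem_iota size_drop add0n ltnS leq_subr.
  rewrite -border_lenE //; apply/existsP; exists i; apply/existsP; exists j.
  by rewrite eqxx.
rewrite -border_lenE // => /existsP[i /existsP[j /andP[_ H]]].
by exists i; apply/existsP; exists j.
Qed.

Lemma lsbE u v : size u = size v ->
  lsb u v = find (border_len u v) (iota 0 (size u).+1).
Proof. by move=> suv; apply: eq_find => l; apply: border_lenE. Qed.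

(** Existence of a border is kept in the left side because [find] returns an out-of-range default
    when there is none. *)
Lemma lsb_first_meet u v (i : nat) : size u = size v -> 0 < i < size u ->
  has_int_border u v && (lsb u v == i) = first_meet (rev u) v i.
Proof.
move=> suv iu; rewrite has_intE // lsbE //.
set a := border_len u v; set s := iota _ _.
have nthE l : l < (size u).+1 -> nth 0 s l = l by move=> ?; rewrite nth_iota.
apply/andP/andP.
  move=> [ha /eqP fi]; move: (nth_find 0 ha); rewrite fi nthE; last by lia.
  move=> /andP[_ ->]; split=> //; apply/avoidP => l lP.
  have := @before_find _ 0 a s l; rewrite fi nthE; last by lia.
  move=> /(_ ltac:(lia)); rewrite /a /border_len.
  have -> : 0 < l < size u by lia.
  by move=> /= ->.
move=> [mi /avoidP av].
have ha : has a s.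
  by apply/hasP; exists i; [rewrite mem_iota; lia | rewrite /a /border_len iu].
split=> //; move: (ha); rewrite has_find size_iota => fl.
move: (nth_find 0 ha); rewrite nthE // => /andP[fP fm].
case: (ltngtP (find a s) i) => //.
  by move=> fi; have := av (find a s); rewrite fm; lia.
move=> /(@before_find _ 0 a s); rewrite nthE; last by lia.
by rewrite /a /border_len iu mi.
Qed.

Lemma lsb_bound u v : size u = size v -> has_int_border u v -> 0 < lsb u v < size u.
Proof.
move=> suv; rewrite has_intE // lsbE // => ha.
have := nth_find 0 ha; rewrite nth_iota; last by move: ha; rewrite has_find size_iota.
by move=> /andP[].
Qed.

(** Only [i = lsb u v] can contribute, and the other border length is then forced to be [n + g - i].
    The lower bound [i > g] says that this length is less than [n]. *)
Lemma MAB_indicator n g (u v : word) : size u = n -> size v = n ->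
  (MAB u v && ((lsb u v)%:Z + (lsb v u)%:Z - n%:Z == g%:Z)%R : nat) =
  \sum_(g.+1 <= i < n)
     (first_meet (rev u) v i && first_meet (rev v) u (n + g - i)).
Proof.
move=> su sv; rewrite /MAB has_ext_int.
have E (i : nat) : g.+1 <= i < n ->
  (first_meet (rev u) v i && first_meet (rev v) u (n + g - i) : nat) =
  (i == lsb u v) * [&& has_int_border u v, has_int_border v u & lsb v u == n + g - i].
  by move=> iP; rewrite -!lsb_first_meet ?su ?sv //; lia.
rewrite big_nat (eq_bigr _ E) -big_nat sum_nat_delta.
case: (boolP (has_int_border u v)) => [h1|_]; last by rewrite muln0.
case: (boolP (has_int_border v u)) => [h2|_]; last by rewrite muln0.
have := lsb_bound (etrans su (esym sv)) h1; have := lsb_bound (etrans sv (esym su)) h2.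
rewrite /= mulnb su sv => b1 b2; congr nat_of_bool; apply/eqP/andP; lia.
Qed.

(** * Cutting the two words into three blocks *)

(** The times before [a + b] split at [a]: up to [a] only the first blocks matter, and afterwards
    the second blocks run with offsets [ht x] and [ht y]. The tails lie beyond the meeting time. *)
Lemma first_meet_cat a b (x y x' y' z z' : word) :
  size x = a -> size y = a -> size x' = b -> size y' = b -> 0 < b ->
  first_meet (x ++ x' ++ z) (y ++ y' ++ z') (a + b) =
  [&& avoid x y a, ht x + ht x' == ht y + ht y'
    & separated (ht x) (ht y) x' y' b.-1].
Proof.
move=> sx sy sx' sy' b0.
have take_right (w w' t : word) l : size w = a -> size w' = b -> l <= b ->
    ht (take (a + l) (w ++ w' ++ t)) = ht w + ht (take l w').
  move=> sw sw' lb; rewrite -sw takeD take_size_cat // drop_size_cat //.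
  by rewrite count_cat takel_cat // sw'.
rewrite /first_meet /meets !take_right // -{1}sx' -{1}sy' !take_size.
rewrite [RHS]andbCA; congr (_ && _); apply/avoidP/andP.
  move=> H; split.
    apply/avoidP => l lP; have := H l ltac:(lia).
    by rewrite /meets !takel_cat ?sx ?sy //; lia.
  apply/separatedP => l lP; have := H (a + l) ltac:(lia).
  by rewrite /meets !take_right //; try lia; move/eqP.
move=> [/avoidP av /separatedP sp] l lP; case: (leqP l a) => la.
  by rewrite /meets !takel_cat ?sx ?sy //; apply: av; lia.
have := sp (l - a) ltac:(lia).
rewrite -(take_right _ _ z) -?(take_right y _ z') //; try lia.
by rewrite subnKC ?(ltnW la) // /meets => /eqP.
Qed.

Lemma ht_rev_take (x : word) l : l <= size x ->
  ht (take l (rev x)) + ht (take (size x - l) x) = ht x.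
Proof.
move=> lx; rewrite -[in RHS](cat_take_drop (size x - l) x) count_cat addnC.
by rewrite take_rev count_rev.
Qed.

(* Read from its end, a pair of paths with matching total displacement becomes
   the pair of unshifted paths. *)
Lemma separated_rev c d (x y : word) g : size x = g -> size y = g ->
  c + ht x = d + ht y ->
  separated c d (rev x) (rev y) g.-1 = separated 0 0 x y g.-1.
Proof.
move=> sx sy E.
have key l : 0 < l <= g.-1 ->
    (c + ht (take l (rev x)) = d + ht (take l (rev y))) <->
    (ht (take (g - l) x) = ht (take (g - l) y)).
  move=> lP; have := @ht_rev_take x l; have := @ht_rev_take y l.
  rewrite sx sy; lia.
apply/separatedP/separatedP => H l lP; rewrite ?add0n => Hl; apply: (H (g - l)).
- lia.
- by rewrite key ?subKn //; lia.
- lia.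
- by rewrite !add0n -key.
Qed.

Lemma first_meet_factor N g K (x1 y1 x2 y2 x3 y3 : word) :
  0 < N -> 0 < g ->
  size x1 = N -> size y1 = N -> size x2 = g -> size y2 = g ->
  size x3 = K -> size y3 = K ->
  let u := x1 ++ x2 ++ rev x3 in let v := y3 ++ rev y2 ++ rev y1 in
  first_meet (rev u) v (K + g) && first_meet (rev v) u (N + g) =
  [&& avoid x1 y1 N, avoid x3 y3 K, ht x1 + ht x2 == ht y1 + ht y2,
      ht x3 + ht x2 == ht y3 + ht y2, avoid x2 y2 g
    & separated (ht x1) (ht y1) x2 y2 g.-1].
Proof.
move=> N0 g0 sx1 sy1 sx2 sy2 sx3 sy3 /=.
rewrite !rev_cat !revK -!catA !first_meet_cat ?size_rev // !count_rev.
have avC : avoid y1 x1 N = avoid x1 y1 N.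
  by apply/avoidP/avoidP => H l /H; rewrite /meets eq_sym.
have spC : separated (ht y1) (ht x1) y2 x2 g.-1 = separated (ht x1) (ht y1) x2 y2 g.-1.
  by apply/separatedP/separatedP => H l /H; auto.
rewrite avC spC (eq_sym (ht y1 + _)).
case: (boolP (avoid x1 y1 N)) => [/avoidP av1|]; last by rewrite andbF.
case: (boolP (avoid x3 y3 K)) => //= av3.
case: eqP => [E3|] /=; last by rewrite !andbF.
case: eqP => [E1|] /=; last by rewrite !andbF.
rewrite separated_rev // andbC.
have N1 : ht x1 != ht y1.
  by have := av1 N ltac:(lia); rewrite /meets !take_oversize ?sx1 ?sy1.
case: (separated (ht x1) _ _ _ _); rewrite ?andbT ?andbF //=.
apply/separatedP/separatedP => H l lP; last by apply: H; lia.
(* The reversed condition covers times below [g] only. Equality at time [g] would give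
   [ht x2 = ht y2], hence [ht x1 = ht y1], against [N1]. *)
case: (eqVneq l g) => [->|lg]; last by apply: H; lia.
rewrite !take_oversize ?sx2 ?sy2 // !add0n => E2; case/eqP: N1.
by apply: (@addIn (ht x2)); rewrite E1 E2.
Qed.

(** * Lattice path triples as pairs of words *)

Lemma card_pair_tuples n (P : word -> word -> bool) :
  #|[set p : n.-tuple bool * n.-tuple bool | P p.1 p.2]| =
  \sum_(x <- words n) \sum_(y <- words n) P x y.
Proof.
rewrite cardsE -sum1_card big_mkcond /=.
under eq_bigr do rewrite -[if _ then 1 else 0]/(nat_of_bool (P _ _)) .
rewrite -(pair_big xpredT xpredT (fun x y : n.-tuple bool => nat_of_bool (P x y))) /=.
rewrite -(sum_tuple n (fun x => \sum_(y <- words n) P x y)).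
by apply: eq_bigr => x _; rewrite (sum_tuple n (fun y => P x y)).
Qed.

Definition path_point (A : point) (w : word) (t : nat) : point :=
  (A.1 + (ht (take t w))%:Z, A.2 + t%:Z - (ht (take t w))%:Z)%R.

Lemma path_point0 A w : path_point A w 0 = A.
Proof. by case: A => A1 A2; rewrite /path_point take0 /=; congr pair; lia. Qed.

Lemma ptsE A w : pts A w = [seq path_point A w t | t <- iota 0 (size w).+1].
Proof.
elim: w A => [|c w IH] A.
  by rewrite /= path_point0.
rewrite -[LHS]/(A :: pts (step A c) w) IH -[(size (c :: w)).+1]/(1 + (size w).+1).
rewrite iotaD map_cat -[0 + 1]/(1 + 0) iotaDl -map_comp -[LHS]cat1s.
congr (_ ++ _); first by rewrite /= path_point0.
by apply: eq_map => t; case: A c => A1 A2 []; rewrite /path_point /= add0n;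
  move: (count _ _) => h; congr pair; lia.
Qed.

Lemma endptE A w : endpt A w = path_point A w (size w).
Proof. by rewrite /endpt ptsE -addn1 iotaD map_cat last_cat. Qed.

(** Both starting points lie on the antidiagonal of coordinate sum [N] and each step raises the sum
    by one, so a common point is reached at the same time on both paths. *)
Lemma eq_path_point a b N x y s t :
  (path_point (Apt a N) x s == path_point (Apt b N) y t) =
  (s == t) && (a + ht (take s x) == b + ht (take t y)).
Proof.
rewrite /path_point /Apt /= xpair_eqE.
by apply/andP/andP => -[/eqP H1 /eqP H2]; split; apply/eqP; lia.
Qed.

(** The time [s] at which both paths visit [C] is a parameter: it is [g] for the common endpoint of
    p and q, and 0 for the common start of q and p'. *)
Lemma meet_exactlyP a b N (x y : word) s g C : size x = g -> size y = g ->
  path_point (Apt a N) x s = C -> path_point (Apt b N) y s = C -> s <= g ->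
  reflect (forall t, t <= g -> a + ht (take t x) = b + ht (take t y) -> t = s)
          (meet_exactly (pts (Apt a N) x) (pts (Apt b N) y) C).
Proof.
move=> sx sy xC yC sg; rewrite /meet_exactly !ptsE sx sy.
have memE p l w t : t <= l ->
    path_point p w t \in [seq path_point p w t' | t' <- iota 0 l.+1].
  by move=> tl; rewrite map_f // mem_iota.
have := memE (Apt a N) _ x _ sg; have := memE (Apt b N) _ y _ sg.
rewrite xC yC => -> ->; rewrite !andTb; apply: (iffP allP) => [H t tg E|H P /mapP[t]].
  have E' : path_point (Apt a N) x t = path_point (Apt b N) y t.
    by apply/eqP; rewrite eq_path_point E !eqxx.
  have := H _ (memE _ _ _ _ tg); rewrite [X in X \in _]E' memE //.
  by rewrite -xC eq_path_point => /andP[/eqP].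
rewrite mem_iota => tg ->; apply/implyP => /mapP[t' _ /eqP].
rewrite eq_path_point => /andP[/eqP <- /eqP E].
by rewrite -xC (H t) //; lia.
Qed.

(** Here [x] is the word of p and p', and [y] that of q. The [avoid] clause encodes the meeting of q
    and p' at B alone, and the [separated] clause that of p and q at C alone. *)
Definition mid_ok (g l2 l1 k : nat) (x y : word) : bool :=
  [&& k == l2 + ht x, k == l1 + ht y, avoid x y g & separated l2 l1 x y g.-1].

Lemma Ncount_words N g l2 l1 k : 0 < g -> l2 < l1 ->
  Ncount (Apt l2 N) (Apt l1 N) (Apt k (N + g)) =
  \sum_(x <- words g) \sum_(y <- words g) mid_ok g l2 l1 k x y.
Proof.
move=> g0 l21; rewrite /Ncount.
have len l : path_len (Apt l N) (Apt k (N + g)) = g by rewrite /path_len /Apt /=; lia.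
rewrite !len; set C := Apt k (N + g).
rewrite (card_pair_tuples g (fun x y => [&& endpt (Apt l2 N) x == C,
  endpt (Apt l1 N) y == C, meet_exactly (pts (Apt l2 N) x) (pts (Apt l1 N) y) C
  & meet_exactly (pts (Apt l1 N) y) (pts (Apt l1 N) x) (Apt l1 N)])).
apply: eq_sum_words => x sx.
apply: eq_sum_words => y sy; congr nat_of_bool; rewrite /mid_ok !endptE sx sy.
have endE l (w : word) : size w = g ->
    (path_point (Apt l N) w g == Apt k (N + g)) = (k == l + ht w).
  move=> sw; rewrite /path_point /Apt /= xpair_eqE -sw take_size.
  by apply/andP/eqP => [[/eqP H1 /eqP H2]|H]; [|split; apply/eqP]; lia.
rewrite !endE //.
case: eqP => [kx|] //=; case: eqP => [ky|] //=; rewrite andbC; congr (_ && _).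
  apply/(@meet_exactlyP l1 l1 N y x 0 g)/avoidP => //.
  - by rewrite path_point0.
  - by rewrite path_point0.
  - by move=> H l lP; apply/negP => /eqP E; have := H l; rewrite E; lia.
  - move=> H t tg /addnI E; case: (posnP t) => // t0.
    by have := H t; rewrite /meets E eqxx t0 tg => /(_ isT).
apply/(@meet_exactlyP l2 l1 N x y g g)/separatedP => //.
- by apply/eqP; rewrite endE // kx.
- by apply/eqP; rewrite endE // ky.
- by move=> H l lP E; have := H l ltac:(lia) E; lia.
- move=> H t tg E; case: (ltngtP t g) => // [tg'|]; last by rewrite ltnNge tg.
  (* Time 0 is not covered by [separated]; there the two starting points differ because
     [l2 < l1]. *)
  case: (posnP t) => [t0|t0]; first by move: E; rewrite t0 !take0 /=; lia.
  by case: (H t ltac:(lia)).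
Qed.

(** * Ballot-type numbers of non-meeting pairs *)

Definition avoid_ok (N a b : nat) (x y : word) : bool :=
  [&& avoid x y N, a == ht x & b == ht y].

Definition avoid_count (N a b : nat) : nat :=
  \sum_(x <- words N) \sum_(y <- words N) avoid_ok N a b x y.

(** Remove the last letter of each word. Since [a < b], the paths cannot meet at the last time, so
    only the earlier times constrain the shorter words. The factors [0 < a] guard the truncated
    predecessor [a.-1]. *)
Lemma avoid_countS N a b : a < b ->
  avoid_count N.+1 a b =
  avoid_count N a b + (0 < a) * avoid_count N a.-1 b + avoid_count N a b.-1
  + (0 < a) * avoid_count N a.-1 b.-1.
Proof.
move=> ab; rewrite /avoid_count sum_words_rcons !big_distrr -!big_split /=.
apply: eq_sum_words => x sx; rewrite !sum_words_rcons !big_distrr -!big_split /=.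
apply: eq_sum_words => y sy.
have E c c' : avoid_ok N.+1 a b (rcons x c) (rcons y c') =
    [&& avoid x y N, a == ht x + c & b == ht y + c'].
  rewrite /avoid_ok -!cats1 !count_cat /= !addn0.
  have eqbT d : (d == true) = d by case: d.
  rewrite !eqbT; apply/and3P/and3P => -[/avoidP av /eqP Ha /eqP Hb]; split;
    rewrite -?Ha -?Hb //; apply/avoidP => l lP.
    have := av l ltac:(lia); rewrite /meets !takel_cat ?sx ?sy //; lia.
  have [lN|lN] : l <= N \/ l = N.+1 by lia.
    by rewrite /meets !takel_cat ?sx ?sy //; apply: av; lia.
  rewrite /meets !take_oversize ?size_cat ?sx ?sy ?lN ?addn1 //.
  by rewrite !count_cat /= !addn0 !eqbT -Ha -Hb; lia.
rewrite !E /avoid_ok !addn0 !addn1.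
have Eb : (b == (ht y).+1) = (b.-1 == ht y) by case: (b) ab.
case: a ab {E} => [|a] ab; rewrite Eb ?mul0n ?mul1n ?addn0 /= ?eqSS.
  by rewrite !andbF add0n addnC.
by ring.
Qed.

Lemma avoid_count_diag N a : 0 < N -> avoid_count N a a = 0.
Proof.
move=> N0; rewrite /avoid_count (eq_sum_words (G := fun=> 0)) ?big1 // => x sx.
rewrite (eq_sum_words (G := fun=> 0)) ?big1 // => y sy.
apply/eqP; rewrite eqb0; apply/negP => /and3P[/avoidP /(_ N)].
rewrite leqnn N0 /meets !take_oversize ?sx ?sy // => /(_ isT) ne /eqP ax /eqP ay.
by rewrite -ax -ay eqxx in ne.
Qed.

Lemma avoid_count0 a b : avoid_count 0 a b = (a == 0) && (b == 0).
Proof.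
rewrite /avoid_count !sum_words0 /avoid_ok /=; congr nat_of_bool.
by have -> : avoid [::] [::] 0 by apply/avoidP => l; lia.
Qed.

(** The first steps of the two paths are forced to differ, and the difference of the two binomial
    products is the Lindström-Gessel-Viennot determinant for the remaining [M] steps. The proof is
    by induction: both sides obey the recurrence of [avoid_countS] by Pascal's rule. The diagonal
    [a = b] is included because the recurrence reaches it from [b = a + 1]. *)
Lemma avoid_count_bin M a b : a <= b ->
  avoid_count M.+1 a b + 'C(M.+1, a) * 'C(M, b) = 'C(M, a) * 'C(M.+1, b).
Proof.
elim: M a b => [|M IH] a b; rewrite leq_eqVlt => /orP[/eqP <-|ab];
  rewrite ?avoid_count_diag 1?[_ * 'C(_, a) in LHS]mulnC //;
  rewrite avoid_countS //.
  rewrite !avoid_count0; case: a b ab => [|[|a]] [|[|b]] //= ab;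
  by rewrite ?bin0 ?bin1 ?bin0n ?bin1n //.
case: b ab => // b ab; case: a ab => [|a] ab.
  have := IH 0 b (leq0n _); have := IH 0 b.+1 (leq0n _).
  by rewrite (binS M.+1) (binS M b) !bin0 /=; lia.
have := IH a b ltac:(lia); have := IH a.+1 b ltac:(lia).
have := IH a b.+1 ltac:(lia); have := IH a.+1 b.+1 ltac:(lia).
rewrite /= (binS M.+1 a) (binS M.+1 b) (binS M a) (binS M b).
rewrite !mulnDl !mulnDr; lia.
Qed.

Lemma avoid_countE N a b : 0 < N -> a < b ->
  ((avoid_count N a b)%:R = (b - a)%:R / N%:R * 'C(N, b)%:R * 'C(N, a)%:R :> rat)%R.
Proof.
case: N => // M _ ab; have E := avoid_count_bin M (ltnW ab).
have H : M.+1 * avoid_count M.+1 a b = (b - a) * 'C(M.+1, b) * 'C(M.+1, a).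
  have /= Ha := mul_bin_down M.+1 a; have /= Hb := mul_bin_down M.+1 b.
  (* For [b] beyond [M.+1] both binomials in [b] vanish; otherwise [M.+1 - b] is an exact
     subtraction and the absorption identities [Ha] and [Hb] can be subtracted. *)
  case: (leqP b M.+1) => bM; last first.
    rewrite [in RHS]bin_small // muln0 mul0n.
    by move: E; rewrite (@bin_small M.+1 b) // (@bin_small M b); lia.
  apply/eqP; rewrite -(eqn_add2r (M.+1 * ('C(M.+1, a) * 'C(M, b)))) -mulnDr E.
  rewrite mulnA Ha [in X in _ == _ + X]mulnCA Hb.
  have -> : M.+1 - a = (b - a) + (M.+1 - b) by lia.
  by apply/eqP; ring.
have M0 : (M.+1%:R != 0 :> rat)%R by rewrite pnatr_eq0.
apply: (mulfI M0); rewrite -natrM H !natrM; field.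
by rewrite addrC natr1.
Qed.

(** * Ranges of the abscissae and summation over the blocks *)

(** This yields the lower bound [l2 + 2] on [l1]. If [b = a + 1], the difference of the two heights
    changes by at most one per step and must avoid 0 and 1 at times 1 to [g - 1], so it stays
    negative; it cannot reach its final value 1 in one last step. *)
Lemma separated_gap g (x y : word) a b : 2 < g -> size x = g -> size y = g ->
  a + ht x = b + ht y -> separated a b x y g.-1 -> avoid x y g -> a < b ->
  a + 2 <= b.
Proof.
move=> g2 sx sy E /separatedP sp /avoidP av ab; rewrite addn2 ltn_neqAle ab andbT.
apply/eqP => ba; subst b.
have htS (w : word) t : ht (take t w) <= ht (take t.+1 w) <= (ht (take t w)).+1.
  elim: w t => [|c w IH] [|t] //=; first by rewrite take0; case: c.
  by have := IH t; case: c => /=; lia.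
have neg t : 0 < t <= g.-1 -> ht (take t x) < ht (take t y).
  elim: t => [|t IH] // tP.
  have := sp _ tP; have := av t.+1 ltac:(lia); rewrite /meets.
  have := htS x t; have := htS y t.
  case: (posnP t) => [->|t0]; first by rewrite !take0 /=; lia.
  by have := IH ltac:(lia); lia.
have := neg g.-1 ltac:(lia); have := htS x g.-1; have := htS y g.-1.
rewrite prednK ?(@take_oversize _ g) ?sx ?sy //; last by lia.
lia.
Qed.

(** The inner bounds may depend on the outer indices but not on [w]; this lets the word sums be
    peeled off one block at a time. *)
Lemma exchange_sum4 (T : Type) (r : seq T) (a1 b1 : nat) (a2 b2 : nat -> nat)
    (a3 b3 : nat -> nat -> nat)
    (a4 b4 : nat -> nat -> nat -> nat) (F : T -> nat -> nat -> nat -> nat -> nat) :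
  \sum_(w <- r) \sum_(a1 <= l < b1) \sum_(a2 l <= k < b2 l)
    \sum_(a3 l k <= p < b3 l k) \sum_(a4 l k p <= q < b4 l k p) F w l k p q =
  \sum_(a1 <= l < b1) \sum_(a2 l <= k < b2 l)
    \sum_(a3 l k <= p < b3 l k) \sum_(a4 l k p <= q < b4 l k p)
      \sum_(w <- r) F w l k p q.
Proof.
rewrite exchange_big; apply: eq_bigr => l _; rewrite exchange_big.
apply: eq_bigr => k _; rewrite exchange_big; apply: eq_bigr => p _.
by rewrite exchange_big.
Qed.

Lemma mul_sum3 (T : Type) (r1 s1 r2 s2 r3 s3 : seq T) (a b c : T -> T -> nat) :
  (\sum_(x <- r1) \sum_(y <- s1) a x y) * (\sum_(x <- r2) \sum_(y <- s2) b x y)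
    * (\sum_(x <- r3) \sum_(y <- s3) c x y) =
  \sum_(x1 <- r1) \sum_(x2 <- r2) \sum_(x3 <- r3)
    \sum_(y3 <- s3) \sum_(y2 <- s2) \sum_(y1 <- s1) a x1 y1 * (b x2 y2 * c x3 y3).
Proof.
rewrite -mulnA big_distrl /=; apply: eq_bigr => x1 _.
rewrite [X in _ * X]big_distrl /= big_distrr /=; apply: eq_bigr => x2 _.
rewrite [X in _ * X]big_distrr /= big_distrr /=; apply: eq_bigr => x3 _.
rewrite [X in _ * X]big_distrr /= big_distrr /=.
apply: eq_bigr => y3 _.
rewrite [X in _ * X]big_distrl /= big_distrr /=; apply: eq_bigr => y2 _.
by rewrite big_distrl.
Qed.

Definition pair_ok (N g K : nat) (x1 x2 x3 y1 y2 y3 : word) : bool :=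
  [&& avoid x1 y1 N, avoid x3 y3 K, ht x1 + ht x2 == ht y1 + ht y2,
      ht x3 + ht x2 == ht y3 + ht y2, avoid x2 y2 g,
      separated (ht x1) (ht y1) x2 y2 g.-1 & ht x1 < ht y1].

(** At most one quadruple of indices contributes: [l2] and [l1] are the abscissae after the first
    blocks, [k] that of the common endpoint of the middle blocks, and [m] is the total height of the
    three [y] blocks. The two height equations give [ht y3 - ht x3 = l1 - l2], whence
    [ht x3 = m - k']. *)
Lemma pair_ok_sum N g K (x1 x2 x3 y1 y2 y3 : word) : 2 < g ->
  size x1 = N -> size y1 = N -> size x2 = g -> size y2 = g ->
  size x3 = K -> size y3 = K ->
  (pair_ok N g K x1 x2 x3 y1 y2 y3 : nat) =
  \sum_(0 <= l2 < N - 1) \sum_(l2 + 2 <= l1 < N.+1) \sum_(l1 <= k < (g + l2).+1)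
    \sum_(k + l1 - l2 <= m < (K + k).+1)
      avoid_ok N l2 l1 x1 y1 *
      (mid_ok g l2 l1 k x2 y2 * avoid_ok K (m - (k + l1 - l2)) (m - k) x3 y3).
Proof.
move=> g2 sx1 sy1 sx2 sy2 sx3 sy3; set I := pair_ok _ _ _ _ _ _ _ _ _.
pose h1 := ht x1; pose h2 := ht y1; pose h3 := ht y1 + ht y2.
pose h4 := ht y1 + ht y2 + ht y3.
have T l2 l1 k m : l2 + 2 <= l1 -> l1 <= k -> k + l1 - l2 <= m ->
    avoid_ok N l2 l1 x1 y1 *
    (mid_ok g l2 l1 k x2 y2 * avoid_ok K (m - (k + l1 - l2)) (m - k) x3 y3) =
    ((l2 == h1) * (l1 == h2) * (k == h3)) * ((m == h4) * I) :> nat.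
  move=> l21 lk km; rewrite !mulnb; congr nat_of_bool.
  rewrite /avoid_ok /mid_ok /I /pair_ok /h1 /h2 /h3 /h4.
  case: (l2 =P ht x1) => [e2|_]; last by rewrite !andbF.
  case: (l1 =P ht y1) => [e1|_]; last by rewrite !andbF.
  subst l2 l1; case: (avoid x1 y1 N) => //=; last by rewrite !andbF.
  case: (avoid x3 y3 K) => /=; last by rewrite !andbF.
  case: (avoid x2 y2 g) => /=; last by rewrite !andbF.
  case: (separated _ _ x2 y2 _) => /=; last by rewrite !andbF.
  rewrite ?andbT; move: l21 lk km.
  move: (ht x1) (ht x2) (ht x3) (ht y1) (ht y2) (ht y3) => p1 p2 p3 q1 q2 q3 l21 lk km.
  by apply/idP/idP; lia.
transitivity (\sum_(0 <= l2 < N - 1) (l2 == h1) *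
   \sum_(l2 + 2 <= l1 < N.+1) (l1 == h2) *
     \sum_(l1 <= k < (g + l2).+1) (k == h3) *
       \sum_(k + l1 - l2 <= m < (K + k).+1) (m == h4) * I); last first.
  apply: eq_big_nat => l2 _; rewrite big_distrr /=; apply: eq_big_nat => l1 /andP[P1 _].
  rewrite mulnA big_distrr /=; apply: eq_big_nat => k /andP[P2 _].
  rewrite mulnA big_distrr /=; apply: eq_big_nat => m /andP[P3 _].
  by rewrite -T.
rewrite !sum_nat_delta; case: (boolP I) => [|_]; last by rewrite !muln0.
(* It remains to see that this quadruple lies in the summation ranges: by [gap] for [l1], and by the
   block lengths for the other bounds. *)
move=> /and5P[av1 av3 /eqP E1 /eqP E3 /and3P[av2 sp lt]].
have gap := separated_gap g2 sx2 sy2 E1 sp av2 lt.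
have := count_size (pred1 true) x1; have := count_size (pred1 true) y1.
have := count_size (pred1 true) x2; have := count_size (pred1 true) y2.
have := count_size (pred1 true) x3; have := count_size (pred1 true) y3.
rewrite sx1 sx2 sx3 sy1 sy2 sy3 /h1 /h2 /h3 /h4; move: E1 E3 gap.
move: (ht x1) (ht x2) (ht x3) (ht y1) (ht y2) (ht y3) => p1 p2 p3 q1 q2 q3.
by move=> *; rewrite !mulnb; symmetry; apply/eqP; rewrite eqb1; lia.
Qed.

Lemma count_lsb_lt N g K : 0 < N -> 2 < g ->
  \sum_(u <- words (N + (g + K))) \sum_(v <- words (K + (g + N)))
    [&& first_meet (rev u) v (K + g) && first_meet (rev v) u (N + g)
      & ht (take N u) < ht (take N (rev v))] =
  \sum_(0 <= l2 < N - 1) \sum_(l2 + 2 <= l1 < N.+1) \sum_(l1 <= k < (g + l2).+1)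
    \sum_(k + l1 - l2 <= m < (K + k).+1)
      avoid_count N l2 l1 * Ncount (Apt l2 N) (Apt l1 N) (Apt k (N + g)) *
      avoid_count K (m - (k + l1 - l2)) (m - k).
Proof.
move=> N0 g2; rewrite sum_words_cat.
transitivity (\sum_(0 <= l2 < N - 1) \sum_(l2 + 2 <= l1 < N.+1)
  \sum_(l1 <= k < (g + l2).+1) \sum_(k + l1 - l2 <= m < (K + k).+1)
  \sum_(x1 <- words N) \sum_(x2 <- words g) \sum_(x3 <- words K)
  \sum_(y3 <- words K) \sum_(y2 <- words g) \sum_(y1 <- words N)
      avoid_ok N l2 l1 x1 y1 *
      (mid_ok g l2 l1 k x2 y2 * avoid_ok K (m - (k + l1 - l2)) (m - k) x3 y3));
  last first.
  apply: eq_bigr => l2 _; apply: eq_big_nat => l1 P1; apply: eq_bigr => k _.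
  apply: eq_bigr => m _; rewrite Ncount_words; try lia.
  by rewrite /avoid_count mul_sum3.
pose b4 (l2 l1 k : nat) := k + l1 - l2.
pose sw T r := @exchange_sum4 T r 0 (N - 1) (fun l2 => l2 + 2) (fun=> N.+1)
  (fun _ l1 => l1) (fun l2 _ => (g + l2).+1) b4 (fun _ _ k => (K + k).+1).
rewrite -sw; apply: eq_sum_words => x1 sx1.
rewrite -sw sum_words_cat; apply: eq_sum_words => x2 sx2.
rewrite -sw -sum_words_rev; apply: eq_sum_words => x3 sx3.
rewrite -sw sum_words_cat; apply: eq_sum_words => y3 sy3.
rewrite -sw sum_words_cat -sum_words_rev; apply: eq_sum_words => y2 sy2.
rewrite -sw -sum_words_rev; apply: eq_sum_words => y1 sy1.
rewrite -pair_ok_sum // first_meet_factor //; last by lia.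
(* The prefixes of length [N] of [u] and [rev v] are the blocks [x1] and [y1]. *)
rewrite !rev_cat !revK -!catA !takel_cat ?sx1 ?sy1 // !take_oversize ?sx1 ?sy1 //.
by rewrite /pair_ok -!andbA.
Qed.

(** * Exchange of the two letters *)

Lemma ht_negb (w : word) : ht (map negb w) + ht w = size w.
Proof.
by rewrite size_ht addnC; congr addn; rewrite count_map; apply: eq_count => -[].
Qed.

Lemma meets_negb (x y : word) l : l <= size x -> l <= size y ->
  meets (map negb x) (map negb y) l = meets x y l.
Proof.
move=> lx ly; rewrite /meets -!map_take.
have := ht_negb (take l x); have := ht_negb (take l y); rewrite !size_takel //.
by move=> E1 E2; apply/eqP/eqP; lia.
Qed.

Lemma first_meet_negb (x y : word) i : i <= size x -> i <= size y ->
  first_meet (map negb x) (map negb y) i = first_meet x y i.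
Proof.
move=> ix iy; rewrite /first_meet meets_negb //; congr (_ && _).
by apply/avoidP/avoidP => H l lP; have := H l lP; rewrite meets_negb //; lia.
Qed.

Lemma count_lsb N g K : 0 < N -> 2 < g ->
  \sum_(u <- words (N + (g + K))) \sum_(v <- words (N + (g + K)))
    (first_meet (rev u) v (K + g) && first_meet (rev v) u (N + g)) =
  2 * \sum_(0 <= l2 < N - 1) \sum_(l2 + 2 <= l1 < N.+1) \sum_(l1 <= k < (g + l2).+1)
    \sum_(k + l1 - l2 <= m < (K + k).+1)
      avoid_count N l2 l1 * Ncount (Apt l2 N) (Apt l1 N) (Apt k (N + g)) *
      avoid_count K (m - (k + l1 - l2)) (m - k).
Proof.
move=> N0 g2; rewrite -count_lsb_lt //.
have -> : K + (g + N) = N + (g + K) by lia.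
set n := N + (g + K); set W := words n.
pose J (u v : word) := first_meet (rev u) v (K + g) && first_meet (rev v) u (N + g).
pose lt (u v : word) := ht (take N u) < ht (take N (rev v)).
rewrite mul2n -addnn; transitivity (\sum_(u <- W) \sum_(v <- W) [&& J u v & lt u v] +
  \sum_(u <- W) \sum_(v <- W) [&& J u v & ht (take N (rev v)) < ht (take N u)]);
  last first.
  congr (_ + _).
  rewrite -sum_words_negb; apply: eq_sum_words => u su.
  rewrite -sum_words_negb; apply: eq_sum_words => v sv; congr nat_of_bool.
  rewrite /J -!map_rev !first_meet_negb ?size_rev ?su ?sv; try lia.
  congr (_ && _); rewrite -!map_take.
  have := ht_negb (take N u); have := ht_negb (take N (rev v)).
  rewrite !size_takel ?size_rev ?su ?sv; lia.
rewrite -big_split; apply: eq_sum_words => u su; rewrite -big_split.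
apply: eq_sum_words => v sv; rewrite -/(J u v) /=.
(* The heights at time [N] differ, since [N] precedes the first meeting time [N + g]; so exactly one
   of the two strict inequalities holds. *)
case: (boolP (J u v)) => //= /andP[_ /andP[_ /avoidP /(_ N ltac:(lia))]].
by rewrite /meets /lt; case: ltngtP.
Qed.

(** * Assembly of the formula *)

Lemma Mo_sum n g : 2 < g ->
  Mo g n = 2 * \sum_(g.+1 <= i < n) \sum_(0 <= l2 < n - i - 1)
    \sum_(l2 + 2 <= l1 < (n - i).+1) \sum_(l1 <= k < (g + l2).+1)
    \sum_(k + l1 - l2 <= m < (n - (n + g - i) + k).+1)
      avoid_count (n - i) l2 l1
      * Ncount (Apt l2 (n - i)) (Apt l1 (n - i)) (Apt k (n + g - i))
      * avoid_count (n - (n + g - i)) (m - (k + l1 - l2)) (m - k).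
Proof.
move=> g2; rewrite /Mo (card_pair_tuples n (fun u v => MAB u v &&
  ((lsb u v)%:Z + (lsb v u)%:Z - n%:Z == g%:Z)%R)).
transitivity (\sum_(u <- words n) \sum_(v <- words n) \sum_(g.+1 <= i < n)
  (first_meet (rev u) v i && first_meet (rev v) u (n + g - i))).
  by apply: eq_sum_words => u su; apply: eq_sum_words => v sv; apply: MAB_indicator.
under eq_bigr do rewrite exchange_big.
rewrite exchange_big big_distrr; apply: eq_big_nat => i /andP[gi lin] /=.
(* The block lengths are [N = n - i] and [K = i - g], the latter being [n - j] for
   [j = n + g - i]. *)
have := @count_lsb (n - i) g (i - g) ltac:(lia) g2.
have -> : n - i + (g + (i - g)) = n by lia.
have -> : i - g + g = i by lia.
have -> : n - i + g = n + g - i by lia.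
by have -> : n - (n + g - i) = i - g by lia.
Qed.

Local Open Scope ring_scope.

Theorem mainTheorem8 (n g : nat) (hn : (2 <= n)%N) (hg : (3 <= g)%N) :
  (Mo g n)%:R =
  2 * \sum_(g.+1 <= i < n)
        \sum_(0 <= l2 < n - i - 1)
          \sum_(l2 + 2 <= l1 < (n - i).+1)
            \sum_(l1 <= k < (g + l2).+1)
              \sum_(k + l1 - l2 <= m < (n - (n + g - i) + k).+1)
                ((l1 - l2)%:R / (n - i)%:R
                   * ('C(n - i, l1))%:R * ('C(n - i, l2))%:R
                   * (Ncount (Apt l2 (n - i)) (Apt l1 (n - i)) (Apt k (n + g - i)))%:R
                   * ((l1 - l2)%:R / (n - (n + g - i))%:R)
                   * ('C(n - (n + g - i), m - k))%:R
                   * ('C(n - (n + g - i), m - (k + l1 - l2)))%:R : rat).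
Proof.
rewrite Mo_sum // natrM natr_sum; congr (_ * _).
apply: eq_big_nat => i /andP[gi lin]; rewrite natr_sum.
apply: eq_big_nat => l2 _; rewrite natr_sum.
apply: eq_big_nat => l1 /andP[l21 _]; rewrite natr_sum.
apply: eq_big_nat => k /andP[lk _]; rewrite natr_sum.
apply: eq_big_nat => m /andP[km _].
rewrite !natrM !avoid_countE; try lia.
(* The lower bound on [m] makes the truncated subtractions exact, so the third factor has the same
   gap as the first. *)
have -> : (m - k - (m - (k + l1 - l2)) = l1 - l2)%N by lia.
by rewrite !mulrA.
Qed.
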